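(* For all positive integers $\Delta$, $k$, and $q$, there exists a constant $c(\Delta,k,q)$ such that, if $H_1,\ldots,H_q$ are $k$-uniform hypergraphs each with $n$ vertices and maximum degree $\Delta$, then $r(H_1,\ldots,H_q) \le c(\Delta,k,q)\, n$. Moreover, one may take $c(\Delta,k,q) \le t_k(c\Delta)$ for $k \ge 4$, and $c(\Delta,3,q) \le t_3(c\Delta\log\Delta)$, where the constant $c$ depends on $k$ and $q$.
   Context: A hypergraph is $k$-uniform if every edge has exactly $k$ vertices. The degree of a vertex is the number of edges containing it, and the maximum degree is the largest degree of a vertex. $K_N^{(k)}$ denotes the complete $k$-uniform hypergraph on $N$ vertices. For $k$-uniform hypergraphs $H_1,\ldots,H_q$, the multicolour Ramsey number $r(H_1,\ldots,H_q)$ is the minimum $N$ such that in any $q$-colouring of the edges of $K_N^{(k)}$ with colours $1,\ldots,q$ there is, for some $i$ with $1\le i\le q$, a monochromatic copy of $H_i$ in colour $i$ (a copy is a not necessarily induced subhypergraph isomorphic to $H_i$). The tower function $t_i(x)$ is defined by $t_1(x) = x$ and $t_{i+1}(x) = 2^{t_i(x)}$.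
   Formalization: The bound c(Δ,3,q) ≤ t_3(cΔ log Δ) is stated only for Δ ≥ 2: at Δ = 1 it would read c(1,3,q) ≤ t_3(0) = 2, which is false for q ≥ 5 (take all H_i to be matchings of s triples, s large). *)

(* Defs.v *)
From mathcomp Require Import all_boot all_order all_algebra.
From mathcomp Require Import reals exp.

Set Implicit Arguments.
Unset Strict Implicit.
Unset Printing Implicit Defensive.

Import Order.TTheory GRing.Theory Num.Theory.

(* A hypergraph on the vertex set V is given by its set of edges. *)
Definition hypergraph (V : finType) := {set {set V}}.

Definition uniform (k : nat) (V : finType) (H : hypergraph V) : Prop :=
  forall e, e \in H -> #|e| = k.

Definition degree (V : finType) (H : hypergraph V) (v : V) : nat :=
  #|[set e in H | v \in e]|.

Definition max_degree (V : finType) (H : hypergraph V) : nat :=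
  \max_(v : V) degree H v.

(* The edges of the complete k-uniform hypergraph on the vertex set 'I_N. *)
Definition complete_edge (k N : nat) := {e : {set 'I_N} | #|e| == k}.

(* The image of f is the vertex set of the copy; the edges of H are mapped to
   edges of colour i, and nothing is required of the other k-sets. *)
Definition mono_copy (k N q : nat) (chi : complete_edge k N -> 'I_q)
    (V : finType) (H : hypergraph V) (i : 'I_q) : Prop :=
  exists2 f : V -> 'I_N, injective f &
    forall e, e \in H ->
      exists2 E : complete_edge k N, val E = f @: e & chi E = i.

Definition arrows (k q : nat) (V : 'I_q -> finType)
    (H : forall i, hypergraph (V i)) (N : nat) : Prop :=
  forall chi : complete_edge k N -> 'I_q, exists i, mono_copy chi (H i) i.

(* r is the least N with the Ramsey property. A relation is used so that no
   default value is needed when existence has not been established. *)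
Definition is_ramsey_number (k q : nat) (V : 'I_q -> finType)
    (H : forall i, hypergraph (V i)) (r : nat) : Prop :=
  arrows k H r /\ forall N, arrows k H N -> r <= N.

(* t_1 x = x and t_(i+1) x = 2 ^ (t_i x); only i >= 1 is meaningful. *)
Definition tower (R : realType) (i : nat) (x : R) : R :=
  iter i.-1 (fun y : R => powR 2%:R y) x.

(* Main.v *)
Require Import Defs.
From mathcomp Require Import all_boot all_order all_algebra.
From mathcomp Require Import boolp reals exp.
From mathcomp Require Import zify ring lra.

Set Implicit Arguments.
Unset Strict Implicit.
Unset Printing Implicit Defensive.

(** Put l = k Delta + 1. Every hypergraph considered has a proper strong
    colouring with l colours, so that it is l-partite. By the Erdos-Rado bound,
    every set of R = t_k(O(Delta)) vertices contains a monochromatic l-set;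
    taking one vertex in each of R blocks of size N shows that, for some l
    blocks and some colour i, at least a proportion 1 / (R^l q) of the
    transversals of these blocks are monochromatic in colour i. Hence it is
    enough to embed an l-partite l-uniform hypergraph of maximum degree d with
    O(n) vertices into any subset G of [N]^l of density at least 1 / D, where N
    is linear in n.

    This is done by dependent random choice. Let t = 2 d l, and pick a random
    t-tuple T_j in each part j < l. With positive probability
    T_0 x ... x T_(l-1) lies in G, while for every i few configurations of d
    points y satisfy T_0 x ... x T_i x {(y_j)_(j > i)} in G and have fewer than
    N / b common extensions in part i. The vertices are then embedded greedily,
    from the last part to the first, so that for every vertex the proportion of
    bad completions of its neighbourhood grows at most by a factor K = 2 b d l
    at each step; as it starts below K^-(d l), no vertex ever becomes bad. *)

(** * Counting finite functions *)

Section Counting.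
Variables (I X : finType).
Implicit Types (z : {ffun I -> X}) (i : I) (x : X).

Definition upd z i x : {ffun I -> X} := [ffun j => if j == i then x else z j].

Lemma upd_same z i x : upd z i x i = x.
Proof. by rewrite ffunE eqxx. Qed.

Lemma upd_other z i x j : j != i -> upd z i x j = z j.
Proof. by rewrite ffunE => /negbTE ->. Qed.

(** Exchanging [x] with the old value [z i] is an involution on pairs [(z, x)]. This stands in for
    independence: one coordinate may be resampled at will. *)
Lemma sum_upd i (F : {ffun I -> X} -> nat) :
  \sum_z \sum_x F (upd z i x) = #|X| * \sum_z F z.
Proof.
pose h (u : {ffun I -> X} * X) := (upd u.1 i u.2, u.1 i).
have hK : involutive h.
  case=> z x; rewrite /h /= upd_same; congr pair.
  by apply/ffunP => j; rewrite !ffunE; case: eqP => // ->.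
rewrite pair_bigA /= (reindex_inj (inv_inj hK)) /=.
rewrite (eq_bigr (fun u => F u.1)); last first.
  by move=> u _; congr F; have /(congr1 fst) := hK u.
rewrite -(pair_bigA _ (fun z _ => F z)) /= big_distrr /=.
by apply: eq_bigr => z _; rewrite sum_nat_const.
Qed.

Lemma card_agree (A : {set I}) (h : I -> X) :
  #|[set g : {ffun I -> X} | [forall i in A, g i == h i]]| * #|X| ^ #|A|
    = #|X| ^ #|I|.
Proof.
have [n] := ubnP #|A|; elim: n A => // n IHn A.
case: (set_0Vmem A) => [->|[i iA]] ltAn.
  rewrite cards0 expn0 muln1 -card_ffun -cardsT; apply: eq_card => g.
  by rewrite !inE; apply/forall_inP => j; rewrite inE.
rewrite (cardsD1 i) iA add1n expnS mulnA -[RHS](IHn (A :\ i)); last first.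
  by move: ltAn; rewrite (cardsD1 i) iA.
have cardE (P : pred {ffun I -> X}) : #|[set g | P g]| = \sum_g P g.
  by rewrite -sum1dep_card big_mkcond.
congr (_ * _); rewrite mulnC !cardE -(sum_upd i).
apply: eq_bigr => g _; rewrite (bigD1 (h i)) //= big1 ?addn0; last first.
  move=> x neq_x; case: forall_inP => // /(_ i iA).
  by rewrite upd_same (negbTE neq_x).
congr (nat_of_bool _); apply/forall_inP/forall_inP => agr j.
  by rewrite !inE => /andP[neq_j jA]; have := agr j jA; rewrite upd_other.
have [->|neq_j] := eqVneq j i; first by rewrite upd_same.
by move=> jA; rewrite upd_other //; apply: agr; rewrite !inE neq_j.
Qed.

End Counting.

(** Jensen's inequality without division. In the induction on [t], the families [m z] and [m z ^ t]
    are similarly ordered, so Chebyshev's sum inequality applies. *)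
Lemma power_mean (Z : finType) (m : Z -> nat) t :
  (\sum_z m z) ^ t * #|Z| <= #|Z| ^ t * \sum_z m z ^ t.
Proof.
have cheb s x y : x * y ^ s + y * x ^ s <= x ^ s.+1 + y ^ s.+1.
  wlog lexy : x y / x <= y.
    move=> W; case: (leqP x y) => [/W //|/ltnW/W].
    by rewrite addnC (addnC (y ^ _)).
  have le_s : x ^ s <= y ^ s by case: s => // s; rewrite leq_exp2r.
  rewrite !expnS; nia.
elim: t => [|t IHt].
  by rewrite !expn0 !mul1n sum_nat_const muln1.
have step : (\sum_z m z) * (\sum_z m z ^ t) <= #|Z| * \sum_z m z ^ t.+1.
  have E1 F1 F2 : (\sum_(z : Z) F1 z) * (\sum_(z : Z) F2 z)
      = \sum_z \sum_w F1 z * F2 w.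
    by rewrite big_distrl; apply: eq_bigr => z _; rewrite big_distrr.
  have E2 (F : Z -> nat) : #|Z| * \sum_z F z = \sum_z \sum_(w : Z) F z.
    by rewrite big_distrr; apply: eq_bigr => z _; rewrite sum_nat_const.
  (* Doubling symmetrises the double sum in [z] and [w], so that [cheb] applies termwise. *)
  rewrite -(leq_pmul2l (isT : 0 < 2)) !mul2n -!addnn.
  rewrite {2}mulnC !E1 E2.
  rewrite [X in _ <= _ + X]exchange_big /=.
  rewrite -!big_split; apply: leq_sum => z _ /=.
  rewrite -!big_split; apply: leq_sum => w _ /=.
  by rewrite [X in _ + X]mulnC; apply: cheb.
rewrite expnS -mulnA (leq_trans (leq_mul (leqnn _) IHt)) //.
by rewrite mulnCA expnSr -mulnA leq_mul2l step orbT.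
Qed.

Lemma pigeonhole (Z C : finType) (S : {set Z}) (P : C -> pred Z) :
  0 < #|S| -> (forall z, z \in S -> exists c, P c z) ->
  exists c, #|S| <= #|C| * #|[set z in S | P c z]|.
Proof.
case/card_gt0P=> z0 z0S SP.
have C0 : 0 < #|C| by have [c _] := SP z0 z0S; apply/card_gt0P; exists c.
have [c maxc] := eq_bigmax (fun c => #|[set z in S | P c z]|) C0.
exists c; rewrite -maxc -sum_nat_const.
apply: (@leq_trans (\sum_c #|[set z in S | P c z]|)); last first.
  by apply: leq_sum => c' _; apply: leq_bigmax.
under [X in _ <= X]eq_bigr do rewrite -sum1dep_card big_mkcond.
rewrite -sum1_card exchange_big big_mkcond leq_sum //= => z _.
case: ifP => // zS; have [c' Pc'] := SP z zS.
by rewrite (bigD1 c') //= Pc'.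
Qed.

(** * Ramsey's theorem with tower-type bounds *)

Definition homogeneous (k q : nat) (T : finType) (chi : {set T} -> 'I_q)
    (L : {set T}) (i : 'I_q) : Prop :=
  forall K : {set T}, K \subset L -> #|K| = k -> chi K = i.

Definition ramsey_bound (k q l m : nat) : Prop :=
  forall (T : finType) (chi : {set T} -> 'I_q) (S : {set T}), m <= #|S| ->
  exists (L : {set T}) (i : 'I_q),
    [/\ L \subset S, #|L| = l & homogeneous k chi L i].

Lemma subset_of_card (T : finType) (S : {set T}) l :
  l <= #|S| -> exists2 L : {set T}, L \subset S & #|L| = l.
Proof.
move=> lS; have : 0 < #|[set L : {set T} | L \subset S & #|L| == l]|.
  by rewrite cards_draws bin_gt0.
by case/card_gt0P=> L; rewrite inE => /andP[LS /eqP]; exists L.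
Qed.

Lemma ramsey_bound1 q l : 0 < l -> ramsey_bound 1 q l (q * l).
Proof.
move=> l0 T chi S leS.
have q0 : 0 < q := leq_ltn_trans (leq0n _) (ltn_ord (chi set0)).
have S0 : 0 < #|S| by rewrite (leq_trans _ leS) // muln_gt0 q0.
have [c] := pigeonhole (P := fun c x => chi [set x] == c) S0
  (fun z _ => ex_intro _ (chi [set z]) (eqxx _)).
rewrite card_ord => cS.
have : l <= #|[set z in S | chi [set z] == c]|.
  by rewrite -(leq_pmul2l q0) (leq_trans leS).
case/subset_of_card=> L /subsetP LS cardL; exists L, c; split=> //.
  by apply/subsetP=> x /LS; rewrite inE => /andP[].
move=> K KL /eqP/cards1P[x defK]; move: KL; rewrite defK sub1set => /LS.
by rewrite inE => /andP[_ /eqP].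
Qed.

(** [x] is the newly selected vertex and [A] holds the earlier ones. The vertices of [S] are sorted
    by the colours they give with [x] and each (k-1)-subset of [A]; at most [q ^ 'C(m, k.-1)] such
    profiles exist. *)
Lemma refine_colours (T : finType) q k (chi : {set T} -> 'I_q)
    (A S : {set T}) m x :
  0 < k -> #|A| <= m -> 0 < q -> S != set0 ->
  exists S' : {set T}, [/\ S' \subset S, #|S| <= q ^ 'C(m, k.-1) * #|S'| &
    forall (K : {set T}) y z, x \in K -> K \subset x |: A -> #|K| = k ->
      y \in S' -> z \in S' -> chi (y |: K) = chi (z |: K)].
Proof.
move=> k0 Am q0; rewrite -card_gt0 => S0.
pose D := [set K : {set T} | K \subset A :\ x & #|K| == k.-1].
pose phi y := [ffun K : {K : {set T} | K \in D} => chi (y |: (x |: val K))].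
have [c cS] := pigeonhole (P := fun c y => phi y == c) S0
  (fun z _ => ex_intro _ (phi z) (eqxx _)).
exists [set y in S | phi y == c]; split.
- by apply/subsetP=> y; rewrite inE => /andP[].
- apply: leq_trans cS _; rewrite leq_mul2r; apply/orP; right.
  rewrite card_ffun card_ord card_sig cards_draws leq_pexp2l //.
  by rewrite leq_bin2l // (leq_trans _ Am) // subset_leq_card ?subD1set.
move=> K y z xK KA cardK; rewrite !inE => /andP[_ /eqP yc] /andP[_ /eqP zc].
have KD : K :\ x \in D.
  rewrite inE; move: cardK; rewrite (cardsD1 x) xK => <-; rewrite eqxx andbT.
  apply/subsetP=> u; rewrite !inE => /andP[neq_u /(subsetP KA)].
  by rewrite !inE (negbTE neq_u).
have /ffunP/(_ (exist (fun K => K \in D) _ KD)) : phi y = phi z.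
  by rewrite yc zc.
by rewrite !ffunE /= setD1K.
Qed.

(* The Erdos-Rado selection: w is the element of K that was selected last, and
   the colour of a set does not depend on its last element, which may thus be
   replaced with x0. *)
Lemma end_homogeneous_set (T : finType) q k (chi : {set T} -> 'I_q) m0 :
  0 < k -> 0 < q -> forall m (A S : {set T}), #|A| + m <= m0 ->
  (2 * q ^ 'C(m0, k.-1)) ^ m <= #|S| ->
  (forall (K : {set T}) y z, K \subset A -> #|K| = k -> y \in S -> z \in S ->
     chi (y |: K) = chi (z |: K)) ->
  [disjoint A & S] ->
  exists (B : {set T}) (x0 : T), [/\ B \subset S, #|B| = m, x0 \in S &
    forall K : {set T}, K \subset A :|: B -> #|K| = k.+1 ->
      ~~ [disjoint K & B] ->
      exists2 w, w \in K & chi K = chi (x0 |: K :\ w)].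
Proof.
move=> k0 q0; set Q := q ^ _; have Q0 : 0 < Q by rewrite expn_gt0 q0.
elim=> [|m IHm] A S Am Sm endA dAS.
  move: Sm; rewrite expn0 => /card_gt0P[x0 x0S].
  exists set0, x0; split; rewrite ?sub0set ?cards0 // => K _ _.
  by rewrite disjoint_sym disjoints_subset sub0set.
have S0 : 0 < #|S| by apply: leq_trans Sm; rewrite expn_gt0 muln_gt0 Q0.
have [x xS] : exists x, x \in S by apply/card_gt0P.
have cardS : #|S| = #|S :\ x|.+1 by rewrite (cardsD1 x) xS.
(* The factor 2 pays for the removal of [x] from [S]. *)
have Sm' : (2 * Q) ^ m * Q <= #|S :\ x|.
  move: Sm; rewrite expnS cardS; have := expn_gt0 (2 * Q) m.
  rewrite muln_gt0 Q0 /=; move: (_ ^ m) => u; nia.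
have Sx0 : S :\ x != set0.
  rewrite -card_gt0 (leq_trans _ Sm') // muln_gt0 Q0 expn_gt0 muln_gt0.
  by rewrite Q0.
have Am' : #|A| <= m0 by apply: leq_trans Am; apply: leq_addr.
have [S' [S'S cardS' homS']] := refine_colours chi x k0 Am' q0 Sx0.
have S'x y : y \in S' -> (y != x) && (y \in S).
  by move/(subsetP S'S); rewrite !inE.
have xA : x \notin A by rewrite (disjointFl dAS).
have [|||| B [x0 [BS' cardB x0S' endB]]] := IHm (x |: A) S'.
- by rewrite cardsU1 xA add1n addSnnS.
- by rewrite -(leq_pmul2l Q0) mulnC (leq_trans Sm').
- move=> K y z KA cardK yS' zS'; have [xK|xK] := boolP (x \in K).
    exact: homS'.
  have [/andP[_ yS] /andP[_ zS]] := (S'x y yS', S'x z zS').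
  apply: endA => //; apply/subsetP=> u uK; have := subsetP KA u uK.
  by rewrite !inE; case: eqP xK uK => // -> /negP.
- rewrite disjoint_sym disjoints_subset; apply/subsetP=> y /S'x.
  rewrite !inE => /andP[neq_y yS]; rewrite negb_or neq_y /=.
  apply: contraTN yS => yA.
  by rewrite (disjointFr dAS).
have [/andP[_ x0S] BS] : (x0 != x) && (x0 \in S) /\ {subset B <= S}.
  by split=> [|y /(subsetP BS')/S'x/andP[]//]; apply: S'x.
have xB : x \notin B by apply/negP=> /(subsetP BS')/S'x; rewrite eqxx.
exists (x |: B), x0; split=> //.
- by apply/subsetP=> y; rewrite !inE => /orP[/eqP->|/BS].
- by rewrite cardsU1 xB cardB.
move=> K; rewrite setUCA setUA => KAB cardK.
(* Sets meeting [B] are covered by induction. In the others [x] was selected last, and [endA]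
   exchanges it for [x0], since both lie in [S]. *)
have [dKB|] := boolP [disjoint K & B]; last first.
  by move=> ndKB _; apply: endB.
move=> KxB; have KxA : K \subset x |: A.
  apply/subsetP=> y yK; have := subsetP KAB y yK.
  by rewrite inE (disjointFr dKB yK) orbF.
have xK : x \in K.
  apply: contraR KxB => xK; rewrite disjoint_sym disjoints_subset.
  apply/subsetP=> y; rewrite !inE => /orP[/eqP->//|yB].
  by rewrite (disjointFl dKB yB).
exists x => //; rewrite -{1}(setD1K xK); apply: endA => //.
  apply/subsetP=> y; rewrite !inE => /andP[/negbTE neq_y /(subsetP KxA)].
  by rewrite !inE neq_y.
by move: cardK; rewrite (cardsD1 x) xK => -[].
Qed.

(** The k-subsets [K] of an end-homogeneous m-set are coloured by [chi (x0 |: K)]; a homogeneous set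
    for this colouring is homogeneous for [chi]. *)
Lemma ramsey_boundS k q l m : 0 < k ->
  ramsey_bound k q l m -> ramsey_bound k.+1 q l ((2 * q) ^ (m ^ k)).
Proof.
move=> k0 Rm T chi S leS.
have q0 : 0 < q := leq_ltn_trans (leq0n _) (ltn_ord (chi set0)).
have leQ : (2 * q ^ 'C(m, k.-1)) ^ m <= #|S|.
  apply: leq_trans leS; have [->|m0] := posnP m.
    by rewrite expn0 expn_gt0 muln_gt0 q0.
  have bin_le : 'C(m, k.-1) * m <= m ^ k.
    rewrite -[in m ^ k](prednK k0) expnSr leq_mul2r; apply/orP; right.
    rewrite -(leq_pmul2r (fact_gt0 k.-1)) bin_ffact.
    apply: (@leq_trans (m ^ k.-1)); last by rewrite leq_pmulr ?fact_gt0.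
    elim: (k.-1) => // j IHj; by rewrite ffactnSr expnSr leq_mul ?leq_subr.
  rewrite !expnMn -expnM leq_mul // leq_pexp2l //.
  by rewrite -[X in X <= _]expn1 leq_pexp2l.
have [|K y z||B [x0 [BS cardB x0S endB]]] :=
    @end_homogeneous_set T q k chi m k0 q0 m set0 S _ leQ.
- by rewrite cards0.
- by rewrite subset0 => /eqP-> K0; move: k0; rewrite -K0 cards0.
- by rewrite disjoints_subset sub0set.
have [|L [i [LB cardL homL]]] := Rm T (fun K => chi (x0 |: K)) B.
  by rewrite cardB.
exists L, i; split=> // [|K KL cardK]; first exact: subset_trans LB BS.
have [|||w wK ->] := endB K => //.
- by rewrite set0U (subset_trans KL).
- have [w wK] : exists w, w \in K by apply/card_gt0P; rewrite cardK.
  apply/negP=> /disjointFr/(_ wK); rewrite (subsetP LB) //.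
  exact: (subsetP KL).
apply: homL; first by apply: subset_trans KL; apply: subD1set.
by move: cardK; rewrite (cardsD1 w) wK => -[].
Qed.

Fixpoint ramsey_nat q l k :=
  if k is k'.+1 then
    if k' is 0 then q * l else (2 * q) ^ (ramsey_nat q l k' ^ k')
  else l.

Lemma ramsey_natP q l k :
  0 < l -> 0 < k -> ramsey_bound k q l (ramsey_nat q l k).
Proof.
move=> l0; case: k => // k _; elim: k => [|k IHk]; first exact: ramsey_bound1.
exact: ramsey_boundS.
Qed.

(** * Dependent random choice *)

Section DependentChoice.
Variables (N l t : nat).
Hypotheses (N0 : 0 < N) (t0 : 0 < t).
Variable G : {set {ffun 'I_l -> 'I_N}}.

Notation point := {ffun 'I_l -> 'I_N}.
Notation sample := {ffun 'I_l -> {ffun 'I_t -> 'I_N}}.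
Implicit Types (T : sample) (y : point) (i : 'I_l).

Definition mix T (m : nat) (s : {ffun 'I_l -> 'I_t}) y : point :=
  [ffun j : 'I_l => if j < m then T j (s j) else y j].

(* trace T m is the set of the y with T_0 x ... x T_(m-1) x {(y_j)_(j >= m)}
   contained in G; the coordinates of y below m are junk. *)
Definition trace T (m : nat) : {set point} :=
  [set y | [forall s, mix T m s y \in G]].

Lemma trace0 T y : (y \in trace T 0) = (y \in G).
Proof.
rewrite inE; have mix0 s : mix T 0 s y = y by apply/ffunP=> j; rewrite ffunE.
apply/forallP/idP => [/(_ [ffun=> Ordinal t0])|yG s]; by rewrite mix0.
Qed.

Lemma eq_trace T T' m y y' :
  (forall j : 'I_l, j < m -> T j = T' j) ->
  (forall j : 'I_l, m <= j -> y j = y' j) ->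
  (y \in trace T m) = (y' \in trace T' m).
Proof.
move=> eqT eqy; rewrite !inE; apply: eq_forallb => s.
suff -> : mix T m s y = mix T' m s y' by [].
by apply/ffunP=> j; rewrite !ffunE; case: ltnP => [/eqT->|/eqy].
Qed.

Lemma traceS T i y :
  (y \in trace T i.+1) = [forall a, upd y i (T i a) \in trace T i].
Proof.
rewrite inE; apply/forallP/forallP=> [Gy a|Gy s].
  rewrite inE; apply/forallP=> s.
  suff -> : mix T i s (upd y i (T i a)) = mix T i.+1 (upd s i a) y by [].
  apply/ffunP=> j; rewrite !ffunE ltnS; case: (ltngtP j i) => [lt|gt|eq].
  - by rewrite -val_eqE (ltn_eqF lt).
  - by rewrite -val_eqE (gtn_eqF gt).
  - by rewrite (ord_inj eq) eqxx.
have := Gy (s i); rewrite inE => /forallP/(_ s).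
suff -> : mix T i s (upd y i (T i (s i))) = mix T i.+1 s y by [].
apply/ffunP=> j; rewrite !ffunE ltnS; case: (ltngtP j i) => [lt|gt|eq].
- by [].
- by rewrite -val_eqE (gtn_eqF gt).
- by rewrite (ord_inj eq) eqxx.
Qed.

Lemma trace_last T y y' : (y \in trace T l) = (y' \in trace T l).
Proof. by apply: eq_trace => // j; rewrite leqNgt ltn_ord. Qed.

(** Irrelevant coordinates are summed over too, so that the counts for all [m] have the same total
    [#|{: sample * point}|]. *)
Definition trace_count (m : nat) : nat :=
  \sum_(T : sample) \sum_(y : point) (y \in trace T m).

Lemma card_samples_in (A : {set 'I_N}) :
  \sum_(tau : {ffun 'I_t -> 'I_N}) [forall a, tau a \in A] = #|A| ^ t.
Proof.
by rewrite -[X in _ ^ X]card_ord -card_ffun_on -sum1_card [RHS]big_mkcond.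
Qed.

(* If m values of the coordinate i keep a point in trace T i, then m ^ t of the
   N ^ t choices of T_i keep it in trace T i.+1; now use convexity. *)
Lemma trace_density_step i :
  trace_count i ^ t * #|{: sample * point}|
    <= #|{: sample * point}| ^ t * trace_count i.+1.
Proof.
pose m (z : sample * point) :=
  #|[set x | upd z.2 i x \in trace z.1 i]|.
have sum_m : \sum_z m z = N * trace_count i.
  rewrite /trace_count big_distrr /= -(pair_bigA _ (fun T y => m (T, y))) /=.
  apply: eq_bigr => T _; rewrite -[X in X * _]card_ord -(sum_upd i).
  by apply: eq_bigr => y _; rewrite /m -sum1dep_card [LHS]big_mkcond.
have sum_mt : \sum_z m z ^ t = N ^ t * trace_count i.+1.
  rewrite /trace_count -(pair_bigA _ (fun T y => m (T, y) ^ t)) exchange_big /=.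
  rewrite [in RHS]exchange_big big_distrr /=; apply: eq_bigr => y _.
  have -> : N ^ t = #|{ffun 'I_t -> 'I_N}| by rewrite card_ffun !card_ord.
  rewrite -(sum_upd i); apply: eq_bigr => T _.
  rewrite -card_samples_in; apply: eq_bigr => tau _; rewrite traceS.
  congr (nat_of_bool _); apply: eq_forallb => b; rewrite inE upd_same.
  by apply: eq_trace => // j lt; rewrite upd_other // -val_eqE (ltn_eqF lt).
have := power_mean m t; rewrite sum_m sum_mt expnMn mulnCA.
by rewrite -mulnA leq_pmul2l // expn_gt0 N0.
Qed.

(** Each of the [l] steps raises the density to the power [t], which turns $1/D$ into $D^{-t^l}$.
    Finally [trace T l] is empty or full, so counting pairs amounts to counting samples. *)
Lemma samples_inside D : N ^ l <= D * #|G| ->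
  #|{: sample}| <= D ^ (t ^ l) * #|[set T | trace T l == setT]|.
Proof.
move=> GD; set Z := #|{: sample * point}|.
have pointE : #|{: point}| = N ^ l by rewrite card_ffun !card_ord.
have point0 : 0 < #|{: point}| by rewrite pointE expn_gt0 N0.
have sample0 : 0 < #|{: sample}|.
  by rewrite card_ffun !card_ord card_ffun !card_ord !expn_gt0 N0.
have Z0 : 0 < Z by rewrite /Z card_prod muln_gt0 sample0.
have count_ge m : m <= l -> Z <= D ^ (t ^ m) * trace_count m.
  elim: m => [_|m IHm ltml].
    rewrite /trace_count expn0 expn1.
    rewrite (eq_bigr (fun=> #|G|)) => [|T _]; last first.
      rewrite -[RHS]sum1_card [RHS]big_mkcond.
      by apply: eq_bigr => y _; rewrite trace0.
    by rewrite sum_nat_const /Z card_prod mulnCA leq_mul2l pointE GD orbT.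
  have {IHm}IHm := IHm (ltnW ltml).
  have := trace_density_step (Ordinal ltml); rewrite -/Z /= => step.
  have Zt : 0 < Z ^ t by rewrite expn_gt0 Z0.
  rewrite -(leq_pmul2l Zt).
  apply: (@leq_trans (D ^ t ^ m.+1 * trace_count m ^ t * Z)).
    rewrite leq_mul2r expnSr expnM -expnMn leq_exp2r // IHm.
    by rewrite orbT.
  by rewrite -mulnA [X in _ <= X]mulnCA leq_mul2l step orbT.
have := count_ge l (leqnn l); rewrite /Z card_prod /trace_count.
suff -> : \sum_T \sum_y (y \in trace T l)
    = #|[set T | trace T l == setT]| * #|{: point}|.
  by rewrite mulnA leq_pmul2r.
rewrite -sum1dep_card [in RHS]big_mkcond big_distrl /=; apply: eq_bigr => T _.
have [y0 _] : exists y : point, y \in predT by apply/card_gt0P.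
rewrite (eq_bigr (fun=> nat_of_bool (y0 \in trace T l))) => [|y _]; last first.
  by rewrite (trace_last T y y0).
rewrite sum_nat_const mulnC; congr (_ * _).
suff -> : (trace T l == setT) = (y0 \in trace T l) by case: (_ \in _).
apply/eqP/idP=> [->|y0T]; first exact: in_setT.
by apply/setP=> y; rewrite in_setT (trace_last T y y0).
Qed.

Variables (d b : nat).

Definition common_nbh T i (ys : 'I_d -> point) : {set 'I_N} :=
  [set x | [forall e, upd (ys e) i x \in trace T i]].

Definition bad T i (ys : 'I_d -> point) : bool :=
  [forall e, ys e \in trace T i.+1] && (#|common_nbh T i ys| * b < N).

(** Only [T i] is resampled. The set [A] of common extensions depends on the earlier samples alone,
    and badness forces all [t] new values into [A], which has fewer than $N/b$ elements. *)
Lemma sum_bad i (ys : 'I_d -> point) :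
  (\sum_T bad T i ys) * b ^ t <= #|{: sample}|.
Proof.
have Nt : 0 < N ^ t by rewrite expn_gt0 N0.
rewrite -(leq_pmul2l Nt) mulnA.
have NtE : N ^ t = #|{ffun 'I_t -> 'I_N}| by rewrite card_ffun !card_ord.
rewrite {1}NtE -(sum_upd i) big_distrl mulnC -sum_nat_const.
apply: leq_sum => T _ /=.
set A := common_nbh T i ys.
have [ltA|geA] := ltnP (#|A| * b) N; last first.
  rewrite big1 // => tau _; rewrite /bad.
  suff -> : common_nbh (upd T i tau) i ys = A by rewrite ltnNge geA andbF.
  apply/setP=> x; rewrite !inE; apply: eq_forallb => e.
  by apply: eq_trace => // j lt; rewrite upd_other // -val_eqE (ltn_eqF lt).
apply: (@leq_trans (#|A| ^ t * b ^ t)); last first.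
  by rewrite -expnMn leq_exp2r // ltnW.
rewrite leq_mul2r -card_samples_in; apply/orP; right.
apply: leq_sum => tau _; rewrite /bad.
case: forallP => //= ysT; rewrite (leq_trans (leq_b1 _)) // lt0b.
apply/forallP=> c; rewrite inE; apply/forallP=> e.
have := ysT e; rewrite traceS upd_same => /forallP/(_ c).
rewrite (@eq_trace (upd T i tau) T i _ (upd (ys e) i (tau c))) // => j lt.
by rewrite upd_other // -val_eqE (ltn_eqF lt).
Qed.

Notation label := ('I_d * 'I_l)%type.

(* The label (e, j) stands for the j-th vertex of the e-th edge at some vertex;
   p sends labels of the same vertex to a common representative. Bounding bad
   configurations for each pattern p separately is what accounts for edges that
   intersect in more than one vertex. *)
Definition read (p : {ffun label -> label}) (g : {ffun label -> 'I_N})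
    (e : 'I_d) : point := [ffun j => g (p (e, j))].

(** First moment: an average sample has at most [L / b ^ t] bad triples [(i, p, g)]. The samples of
    [samples_inside] have proportion at least $D^{-t^l}$, so one of them has at most [D ^ (t ^ l)]
    times as many. *)
Lemma good_sample D : N ^ l <= D * #|G| ->
  let M := d * l in
  exists2 T, trace T l = setT & forall i p,
    #|[set g | bad T i (read p g)]| * b ^ t
      <= l * M ^ M * N ^ M * D ^ (t ^ l).
Proof.
move=> GD M; pose L := l * M ^ M * N ^ M.
pose X T := \sum_i \sum_p \sum_g bad T i (read p g).
have sumX : (\sum_T X T) * b ^ t <= #|{: sample}| * L.
  rewrite /X exchange_big big_distrl /=.
  have -> : #|{: sample}| * L = \sum_(i < l) #|{: sample}| * (M ^ M * N ^ M).
    by rewrite sum_nat_const card_ord /L -!mulnA mulnCA.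
  apply: leq_sum => i _; rewrite exchange_big big_distrl /=.
  have labelE : #|{: label}| = M by rewrite card_prod !card_ord.
  have patternE : #|{ffun label -> label}| = M ^ M by rewrite card_ffun labelE.
  have mapE : #|{ffun label -> 'I_N}| = N ^ M.
    by rewrite card_ffun labelE card_ord.
  have -> : #|{: sample}| * (M ^ M * N ^ M)
      = \sum_(p : {ffun label -> label}) #|{: sample}| * N ^ M.
    by rewrite sum_nat_const patternE mulnCA.
  apply: leq_sum => p _; rewrite exchange_big big_distrl /=.
  have -> : #|{: sample}| * N ^ M
      = \sum_(g : {ffun label -> 'I_N}) #|{: sample}|.
    by rewrite sum_nat_const mapE mulnC.
  by apply: leq_sum => g _; apply: sum_bad.
have S0 := samples_inside GD; set S := [set T | _] in S0.
have [T TS XT] : exists2 T, T \in S & X T * b ^ t <= L * D ^ (t ^ l).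
  apply/exists_inP; apply: contraLR sumX => /exists_inPn big.
  rewrite -ltnNge; apply: (@leq_ltn_trans (D ^ (t ^ l) * #|S| * L)).
    by rewrite leq_mul2r S0 orbT.
  have S0' : 0 < #|S|.
    rewrite lt0n; apply: contraTneq S0 => ->; rewrite muln0 -ltnNge.
    by rewrite card_ffun !card_ord card_ffun !card_ord !expn_gt0 N0.
  apply: (@leq_trans (\sum_(T in S) (L * D ^ (t ^ l)).+1)).
    rewrite sum_nat_const mulnS mulnAC mulnC [L * _]mulnC.
    by rewrite -[X in X < _]add0n ltn_add2r.
  rewrite big_distrl big_mkcond leq_sum //= => T _; case: ifP => // TS.
  by rewrite ltnNge big.
exists T => [|i p]; first by move: TS; rewrite inE => /eqP.
apply: leq_trans XT; rewrite leq_mul2r; apply/orP; right.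
rewrite -sum1dep_card big_mkcond /X (bigD1 i) //= (bigD1 p) //=.
by rewrite -addnA leq_addr.
Qed.

End DependentChoice.

(** * Greedy embedding *)

Section GreedyEmbedding.
Variables (N l t d b B : nat) (G : {set {ffun 'I_l -> 'I_N}}).
Variable T : {ffun 'I_l -> {ffun 'I_t -> 'I_N}}.
Let M := d * l.
Let K := 2 * b * M.
Notation label := ('I_d * 'I_l)%type.

Hypotheses (N0 : 0 < N) (t0 : 0 < t) (b0 : 0 < b) (M0 : 0 < M) (B0 : 0 < B).
Hypothesis fullT : trace G T l = setT.
Hypothesis few_bad : forall i p,
  #|[set g | bad (d := d) G b T i (read p g)]| * b ^ t <= B.
Hypothesis small_B : K ^ M * B < N ^ M * b ^ t.

Variables (V E : finType) (vert : E -> 'I_l -> V) (col : V -> 'I_l).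
Variable nbr : V -> 'I_d -> E.
Hypothesis col_vert : forall e j, col (vert e j) = j.
Hypothesis vert_nbr : forall v a, vert (nbr v a) (col v) = v.
Hypothesis nbr_vert : forall e j, exists a, nbr (vert e j) a = e.
Hypothesis cardV : 2 * b * #|V| <= N.

Implicit Types (S : {set V}) (f : {ffun V -> 'I_N}) (u v w : V).

Definition ver u (la : label) : V := vert (nbr u la.1) la.2.

Definition canon u : {ffun label -> label} :=
  [ffun la => odflt la [pick la' | ver u la' == ver u la]].

Lemma K_gt0 : 0 < K.
Proof. by rewrite muln_gt0 M0 muln_gt0 b0. Qed.

Lemma ver_canon u la : ver u (canon u la) = ver u la.
Proof. by rewrite ffunE; case: pickP => //= la' /eqP. Qed.

Lemma eq_canon u la la' : ver u la = ver u la' -> canon u la = canon u la'.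
Proof.
move=> eq_la; rewrite !ffunE -eq_la.
(* The two defaults differ, but [pick] cannot fail, since [la] itself qualifies. *)
by case: pickP => // /(_ la); rewrite eqxx.
Qed.

(** Only canonical labels count, so a vertex reached through several labels is counted once. *)
Definition assigned u S : {set label} :=
  [set la | (canon u la == la) && (ver u la \in S)].

Definition extensions u S f : {set {ffun label -> 'I_N}} :=
  [set g | bad G b T (col u) (read (canon u) g) &
    [forall la in assigned u S, g la == f (ver u la)]].

(* The proportion of bad completions of the neighbourhood of u is at most
   K ^ a * B / (N ^ M * b ^ t), where a labels are already assigned. *)
Definition controlled S f : Prop := forall u,
  #|extensions u S f| * N ^ #|assigned u S| * b ^ t
    <= K ^ #|assigned u S| * B.

(** By the second clause, the vertices of [e] after the j-th are embedded in the third one; values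
    of [f] at earlier vertices may be junk, which [trace G T j] ignores. *)
Definition partial_embedding S f : Prop := [/\ {in S &, injective f},
  (forall w w', w \in S -> col w < col w' -> w' \in S),
  forall e j, vert e j \in S -> [ffun i => f (vert e i)] \in trace G T j
  & controlled S f].

Lemma card_assigned u S : #|assigned u S| <= M.
Proof. by rewrite (leq_trans (max_card _)) // card_prod !card_ord. Qed.

Lemma controlled0 f : controlled set0 f.
Proof.
move=> u; have -> : assigned u set0 = set0.
  by apply/setP=> la; rewrite !inE andbF.
rewrite cards0 !expn0 muln1 mul1n; apply: leq_trans (few_bad (col u) (canon u)).
rewrite leq_mul2r subset_leq_card ?orbT //.
by apply/subsetP=> g; rewrite !inE => /andP[].
Qed.

(** Badness reads only the parts after [col v], where every label is assigned. Bad images would thus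
    make every completion that agrees with [f] bad, and control would contradict [small_B]. *)
Lemma not_bad S f v : controlled S f ->
  (forall a (j : 'I_l), col v < j -> ver v (a, j) \in S) ->
  ~~ bad G b T (col v) (fun a : 'I_d => [ffun i => f (ver v (a, i))]).
Proof.
move=> /(_ v) ctl laterS; apply/negP=> badv.
have all_ext : [set g : {ffun label -> 'I_N} |
    [forall la in assigned v S, g la == f (ver v la)]] \subset extensions v S f.
  apply/subsetP=> g; rewrite !inE => agr; rewrite agr andbT.
  have agree a (j : 'I_l) : col v < j ->
      read (canon v) g a j = [ffun i => f (ver v (a, i))] j.
    move=> lt; have laS : canon v (a, j) \in assigned v S.
      by rewrite inE ver_canon laterS // (eq_canon (ver_canon _ _)) eqxx.
    by have /eqP := forall_inP agr _ laS; rewrite ver_canon !ffunE.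
  have [/forallP badv1 badv2] := andP badv; apply/andP; split.
    apply/forallP=> a; rewrite (eq_trace (T' := T) _ _ (agree a)) //.
  rewrite (_ : common_nbh _ _ _ _ = common_nbh G T (col v)
     (fun a : 'I_d => [ffun i => f (ver v (a, i))])) //.
  apply/setP=> x; rewrite !inE; apply: eq_forallb => a.
  apply: eq_trace => // j; rewrite leq_eqVlt => /orP[/eqP eqj|lt].
    by rewrite (ord_inj eqj) !upd_same.
  by rewrite !upd_other ?agree // -val_eqE (gtn_eqF lt).
have := small_B; rewrite ltnNge => /negP; apply.
have NA := card_agree (assigned v S) (fun la => f (ver v la)).
have labelE : #|{: label}| = M by rewrite card_prod !card_ord.
rewrite card_ord labelE in NA; rewrite -NA.
apply: leq_trans (leq_trans ctl _).
  by rewrite !leq_mul // subset_leq_card.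
by rewrite leq_mul2r leq_pexp2l ?card_assigned ?orbT ?K_gt0.
Qed.

Lemma assigned_new u v S la0 : v \notin S -> ver u la0 = v ->
  assigned u (v |: S) = canon u la0 |: assigned u S.
Proof.
move=> vS def_v; apply/setP=> la; rewrite !inE.
have [->|neq_la] /= := eqVneq la (canon u la0).
  by rewrite ver_canon def_v eqxx (eq_canon (ver_canon _ _)) eqxx.
case: (eqVneq (canon u la) la) => //= fix_la; case: eqP => //= eq_v.
by case/eqP: neq_la; rewrite -fix_la; apply: eq_canon; rewrite eq_v.
Qed.

Lemma extensions_new u v S f x la0 : v \notin S -> ver u la0 = v ->
  extensions u (v |: S) (upd f v x)
    = [set g in extensions u S f | g (canon u la0) == x].
Proof.
move=> vS def_v; apply/setP=> g; rewrite !inE -andbA; congr (_ && _).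
rewrite (assigned_new vS def_v).
have fS la : la \in assigned u S -> upd f v x (ver u la) = f (ver u la).
  rewrite inE => /andP[_ laS]; rewrite upd_other //.
  by apply: contraNneq vS => <-.
apply/forall_inP/andP=> [agr|[/forall_inP agr /eqP gx] la].
  split.
    apply/forall_inP=> la laS.
    by rewrite -fS // agr // in_setU1 laS orbT.
  have := agr (canon u la0); rewrite setU11 ver_canon def_v upd_same.
  exact.
rewrite in_setU1 => /orP[/eqP->|laS]; last by rewrite fS // agr.
by rewrite ver_canon def_v upd_same gx.
Qed.

Lemma unrelated u v S f x : v \notin S -> (forall la, ver u la != v) ->
  assigned u (v |: S) = assigned u S /\
  extensions u (v |: S) (upd f v x) = extensions u S f.
Proof.
move=> vS not_v.
have eqA : assigned u (v |: S) = assigned u S.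
  by apply/setP=> la; rewrite !inE (negbTE (not_v la)).
split=> //; apply/setP=> g; rewrite !inE eqA; congr (_ && _).
by apply: eq_forallb_in => la _; rewrite upd_other.
Qed.

Definition overloaded S f v u : {set 'I_N} :=
  [set x | K ^ #|assigned u (v |: S)| * B <
     #|extensions u (v |: S) (upd f v x)| * N ^ #|assigned u (v |: S)| * b ^ t].

(** The extensions for [S] split into those for [v |: S] by their value [x] at the label of [v]. An
    overloaded [x] takes more than $K/N$ of the bound on the total, so there are at most $N/K$ of
    them. *)
Lemma card_overloaded S f v u la0 : v \notin S -> controlled S f ->
  ver u la0 = v -> #|overloaded S f v u| * K <= N.
Proof.
move=> vS ctl def_v; set O := overloaded S f v u.
have cardA : #|assigned u (v |: S)| = #|assigned u S|.+1.
  rewrite (assigned_new vS def_v) cardsU1 inE ver_canon def_v (negbTE vS).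
  by rewrite andbF.
have sum_ext : \sum_x #|extensions u (v |: S) (upd f v x)|
    = #|extensions u S f|.
  pose at_label (g : {ffun label -> 'I_N}) := g (canon u la0).
  rewrite -[RHS]sum1_card (partition_big at_label predT) //=.
  by apply: eq_bigr => x _; rewrite (extensions_new _ _ vS def_v) -sum1dep_card.
set a := #|assigned u S| in cardA *.
have Ka : 0 < K ^ a * B by rewrite muln_gt0 B0 expn_gt0 K_gt0.
rewrite -(leq_pmul2r Ka).
apply: (@leq_trans (N * (#|extensions u S f| * N ^ a * b ^ t))); last first.
  by rewrite leq_mul2l ctl orbT.
rewrite -sum_ext !big_distrl big_distrr /= -!mulnA -sum_nat_const.
rewrite big_mkcond leq_sum //= => x _; case: ifP => //.
rewrite inE cardA !expnS => /ltnW; rewrite -!mulnA => /leq_trans-> //.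
by rewrite mulnCA.
Qed.

(** There are at least $N/b$ candidates for [v]. Fewer than $N/(2b)$ values are used, and each of
    the at most [M] vertices on an edge with [v] rules out at most $N/K$ more, hence at most
    $N/(2b)$ together. *)
Lemma embedding_step S f v : v \notin S -> partial_embedding S f ->
  (forall w, col v < col w -> w \in S) ->
  exists f', partial_embedding (v |: S) f'.
Proof.
move=> vS [injf closedS edgef ctl] laterS.
pose ys a : {ffun 'I_l -> 'I_N} := [ffun i => f (ver v (a, i))].
pose Y := common_nbh G T (col v) ys.
have Y_big : N <= #|Y| * b.
  have later a (j : 'I_l) : col v < j -> ver v (a, j) \in S.
    by move=> lt; apply: laterS; rewrite col_vert.
  have := not_bad ctl later; rewrite negb_and -leqNgt => /orP[|//].
  case/negP; apply/forallP=> a.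
  (* Either the next vertex of the edge is already embedded, or [v] lies in the last part and
     [fullT] applies. *)
  have [lt|ge] := ltnP (col v).+1 l.
    have := edgef (nbr v a) (Ordinal lt); apply.
    by rewrite laterS // col_vert.
  have -> : (col v).+1 = l by apply/eqP; rewrite eqn_leq ltn_ord.
  by rewrite fullT in_setT.
pose R := [set u | [exists la, ver u la == v]].
have R_small : #|R| <= M.
  apply: (@leq_trans #|[set ver v la | la in [set: label]]|); last first.
    by rewrite (leq_trans (leq_imset_card _ _)) // cardsT card_prod !card_ord.
  apply/subset_leq_card/subsetP=> u; rewrite inE => /existsP[[a j] /eqP def_v].
  have [a' def_a'] := nbr_vert (nbr u a) j.
  apply/imsetP; exists (a', col u); rewrite ?inE // /ver /=.
  by rewrite -[v]def_v [nbr _ _]def_a' vert_nbr.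
pose F := (f @: S) :|: \bigcup_(u in R) overloaded S f v u.
have SV : #|S| < #|V|.
  rewrite -cardsT proper_card // properT.
  by apply: contraNneq vS => ->; rewrite inE.
have sumO : K * \sum_(u in R) #|overloaded S f v u| <= M * N.
  apply: (@leq_trans (#|R| * N)); last by rewrite leq_mul2r R_small orbT.
  rewrite big_distrr -sum_nat_const leq_sum //= => u.
  rewrite inE => /existsP[la /eqP def_v]; rewrite mulnC.
  exact: card_overloaded def_v.
have F_small : #|F| * b < N.
  have cardF : #|F| <= #|S| + \sum_(u in R) #|overloaded S f v u|.
    apply: leq_trans (leq_card_setU _ _) _; rewrite leq_add ?leq_imset_card //.
    elim/big_rec2: _ => [|u n A _ le_n]; first by rewrite cards0.
    by apply: leq_trans (leq_card_setU _ _) _; rewrite leq_add2l.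
  have SN : 2 * b * #|S| < N.
    by apply: leq_trans cardV; rewrite ltn_pmul2l // muln_gt0.
  have OM : 2 * b * \sum_(u in R) #|overloaded S f v u| <= N.
    by rewrite -(leq_pmul2l M0) mulnA [M * _]mulnC.
  move: cardF SN OM; move: #|F| #|S| (\sum_(u in R) _) => x y z; nia.
have [x xY xF] : exists2 x, x \in Y & x \notin F.
  apply/subsetPn; apply: contraL F_small => /subset_leq_card YF.
  by rewrite -leqNgt (leq_trans Y_big) // leq_mul2r YF orbT.
move: xF; rewrite inE negb_or => /andP[x_new x_ok].
exists (upd f v x); split.
- move=> w w' ; rewrite !inE.
  have fS u : u \in S -> upd f v x u = f u.
    by move=> uS; rewrite upd_other //; apply: contraNneq vS => <-.
  have xS u : u \in S -> f u <> x.
    by move=> uS fu; case/negP: x_new; rewrite -fu imset_f.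
  case: (eqVneq w v) => [->|_] /=; case: (eqVneq w' v) => [-> //|_] /=.
  + by move=> _ w'S; rewrite upd_same fS // => /esym/xS.
  + by move=> wS _; rewrite upd_same fS // => /xS.
  + by move=> wS w'S; rewrite !fS //; apply: injf.
- move=> w w'; rewrite !in_setU1 => /orP[/eqP->|wS] lt.
    by rewrite laterS ?orbT.
  by rewrite (closedS w) ?orbT.
- move=> e j; rewrite in_setU1 => /orP[/eqP def_v|ejS].
    have [a def_e] := nbr_vert e j; rewrite def_v in def_e.
    have col_v : col v = j by rewrite -def_v col_vert.
    move: xY; rewrite inE => /forallP/(_ a); rewrite -col_v.
    rewrite (@eq_trace _ _ _ G T T _ _
      [ffun i => upd f v x (vert e i)]) // => i.
    rewrite leq_eqVlt => /orP[/eqP/ord_inj eqi|lt].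
      by rewrite -eqi upd_same ffunE {1}col_v def_v upd_same.
    have neq_i : i != col v by rewrite -val_eqE (gtn_eqF lt).
    have neq_v : vert e i != v.
      by apply: contraNneq neq_i => <-; rewrite col_vert.
    rewrite (upd_other _ _ neq_i) [RHS]ffunE (upd_other _ _ neq_v) ffunE.
    by rewrite /ver /= def_e.
  rewrite (@eq_trace _ _ _ G T T _ _
    [ffun i => f (vert e i)]) ?edgef // => i le.
  rewrite [LHS]ffunE [RHS]ffunE upd_other //; apply: contraNneq vS => def_v.
  move: le; rewrite leq_eqVlt => /orP[/eqP/ord_inj eqi|lt].
    by rewrite -def_v -eqi.
  by apply: (closedS _ v ejS); rewrite -def_v !col_vert.
move=> u; have [/existsP[la /eqP def_v]|/existsPn not_v] :=
  boolP [exists la, ver u la == v].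
  rewrite leqNgt; apply: contra x_ok => big; apply/bigcupP; exists u.
    by rewrite inE; apply/existsP; exists la; rewrite def_v.
  by rewrite inE.
by have [-> ->] := unrelated f x vS not_v.
Qed.

Lemma greedy_embedding : exists f : {ffun V -> 'I_N},
  injective f /\ forall e, [ffun i => f (vert e i)] \in G.
Proof.
have step n : n <= #|V| -> exists S f, #|S| = n /\ partial_embedding S f.
  elim: n => [_|n IHn ltn].
    exists set0, [ffun=> Ordinal N0]; split; first by rewrite cards0.
    split=> [v w|v w|e j|]; rewrite ?in_set0 //; exact: controlled0.
  have [S [f [cardS embf]]] := IHn (ltnW ltn).
  have /card_gt0P[v0 v0S] : 0 < #|~: S|.
    by rewrite -(ltn_add2l #|S|) addn0 cardsC cardS.
  have [v vS maxv] := arg_maxnP (fun v => val (col v)) v0S.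
  have vS' : v \notin S by rewrite -in_setC.
  have [|f' embf'] := embedding_step vS' embf.
    move=> w; apply: contraLR => wS; rewrite -leqNgt; apply: maxv.
    by rewrite -in_setC in wS.
  by exists (v |: S), f'; rewrite cardsU1 vS' cardS.
have [S [f [cardS [injf _ edgef _]]]] := step _ (leqnn _).
have ST v : v \in S.
  have /eqP-> : S == setT by rewrite eqEcard subsetT cardsT cardS leqnn.
  exact: in_setT.
exists f; split=> [v w|e]; first exact: injf.
have l0 : 0 < l by move: M0; rewrite muln_gt0 => /andP[].
by rewrite -(trace0 t0 G T); apply: (edgef e (Ordinal l0)).
Qed.

End GreedyEmbedding.

(** This is the value of [b]. With [M = d * l], [t = 2 * M] and [y = l * D ^ (t ^ l)] it is
    [4 * M ^ 2 * y], which reduces [small_B] to [y < 2 ^ M * y ^ M]. *)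
Definition sparsity (d l D : nat) : nat :=
  4 * (d * l) ^ 2 * l * D ^ ((2 * (d * l)) ^ l).

Lemma sparsity_gt0 d l D : 0 < d -> 0 < l -> 0 < D -> 0 < sparsity d l D.
Proof.
move=> d0 l0 D0; by rewrite /sparsity !(muln_gt0, expn_gt0) d0 l0 D0.
Qed.

Lemma dense_embedding N l d D (G : {set {ffun 'I_l -> 'I_N}}) (V E : finType)
    (vert : E -> 'I_l -> V) (col : V -> 'I_l) :
  0 < N -> 0 < l -> 0 < d -> N ^ l <= D * #|G| ->
  (forall e j, col (vert e j) = j) ->
  (forall v, exists e, vert e (col v) = v) ->
  (forall v, #|[set e | vert e (col v) == v]| <= d) ->
  2 * sparsity d l D * #|V| <= N ->
  exists f : {ffun V -> 'I_N},
    injective f /\ forall e, [ffun i => f (vert e i)] \in G.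
Proof.
move=> N0 l0 d0 GD col_vert covered deg_le cardV.
pose M := d * l; have M0 : 0 < M by rewrite muln_gt0 d0.
have D0 : 0 < D.
  rewrite lt0n; apply: contraTneq GD => ->.
  by rewrite mul0n -ltnNge expn_gt0 N0.
have t0 : 0 < 2 * M by rewrite muln_gt0 M0.
set D' := D ^ ((2 * M) ^ l); have D'0 : 0 < D' by rewrite expn_gt0 D0.
set b := sparsity d l D in cardV.
have bE : b = (2 * M) * (2 * (M * (l * D'))).
  by rewrite /b /sparsity -/M -/D'; ring.
have b0 : 0 < b.
  rewrite bE (muln_gt0 (_ * M)) t0 (muln_gt0 2) (muln_gt0 M) M0.
  by rewrite (muln_gt0 l) l0.
have [T fullT few] := good_sample N0 t0 d b GD.
pose es v := enum [set e | vert e (col v) == v].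
have nbrP v : exists h : 'I_d -> E, (forall a, vert (h a) (col v) = v) /\
    (forall e, vert e (col v) = v -> exists a, h a = e).
  (* The list of edges at [v] is padded with [e0] to length [d]; repeated edges only repeat
     conditions. *)
  have [e0 e0v] := covered v; exists (fun a => nth e0 (es v) a).
  have es_in e : (e \in es v) = (vert e (col v) == v) by rewrite mem_enum inE.
  have es_size : size (es v) <= d by rewrite -cardE.
  split=> [a|e ev].
    have [lt|ge] := ltnP a (size (es v)); last by rewrite nth_default.
    by apply/eqP; rewrite -es_in mem_nth.
  have lt : index e (es v) < size (es v) by rewrite index_mem es_in ev.
  by exists (Ordinal (leq_trans lt es_size)); rewrite nth_index // es_in ev.
have [nbr nbrE] := fin_all_exists nbrP.
apply: (@greedy_embedding N l (2 * M) d b _ G T _ _ _ _ _ fullT few _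
  V E vert col nbr) => //.
- have MM0 : 0 < M ^ M by rewrite expn_gt0 M0.
  have NM0 : 0 < N ^ M by rewrite expn_gt0 N0.
  by rewrite (muln_gt0 _ D') (muln_gt0 _ (N ^ M)) (muln_gt0 l) l0 MM0 NM0.
- rewrite -/M -/D' mulnC [N ^ M * _]mulnC.
  have -> : l * M ^ M * N ^ M * D' * (2 * b * M) ^ M
     = (2 * M) ^ M * (M ^ M * (l * D')) * b ^ M * N ^ M.
    by rewrite !expnMn; ring.
  have -> : b ^ (2 * M) = b ^ M * b ^ M by rewrite mul2n -addnn expnD.
  rewrite ltn_pmul2r ?expn_gt0 ?N0 // ltn_pmul2r ?expn_gt0 ?b0 //.
  rewrite bE [X in _ < X]expnMn ltn_pmul2l ?expn_gt0 ?t0 //.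
  rewrite (expnMn 2) (expnMn M) [X in _ < X]mulnCA ltn_pmul2l ?expn_gt0 ?M0 //.
  set y := l * D'.
  have y0 : 0 < y by rewrite muln_gt0 l0.
  have : y <= y ^ M by rewrite -{1}[y]expn1; apply: leq_pexp2l.
  have : 1 < 2 ^ M by rewrite -{1}(expn0 2) ltn_exp2l.
  nia.
- by move=> v; case: (nbrE v).
- move=> e j; have [_ nbr_all] := nbrE (vert e j).
  by apply: nbr_all; rewrite col_vert.
Qed.

(** * Reduction to dense tuples *)

(** Greedy colouring: the edges at a vertex cover at most [k * Delta] vertices, so a colour is free,
    even when the junk colours of uncoloured vertices are avoided. *)
Lemma strong_colouring (V : finType) (H : hypergraph V) k Delta :
  uniform k H -> (forall v, degree H v <= Delta) ->
  exists col : V -> 'I_(k * Delta).+1,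
    forall e, e \in H -> {in e &, injective col}.
Proof.
move=> uniH degH.
have step n : n <= #|V| -> exists (S : {set V}) (col : V -> 'I_(k * Delta).+1),
    #|S| = n /\ forall e, e \in H -> {in e :&: S &, injective col}.
  elim: n => [_|n IHn ltn].
    exists set0, (fun=> ord0); split=> [|e _ v w]; first exact: cards0.
    by rewrite setI0 inE.
  have [S [col [cardS colS]]] := IHn (ltnW ltn).
  have /card_gt0P[v vS] : 0 < #|~: S|.
    by rewrite -(ltn_add2l #|S|) addn0 cardsC cardS.
  pose F := col @: \bigcup_(e in [set e in H | v \in e]) e.
  have F_small : #|F| < #|'I_(k * Delta).+1|.
    rewrite card_ord ltnS (leq_trans (leq_imset_card _ _)) //.
    apply: (@leq_trans (\sum_(e in [set e in H | v \in e]) k)).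
      elim/big_rec2: _ => [|e m A]; first by rewrite cards0.
      rewrite inE => /andP[eH _] leA; apply: leq_trans (leq_card_setU _ _) _.
      by rewrite (uniH e eH) leq_add2l.
    by rewrite sum_nat_const mulnC leq_mul2l degH orbT.
  have [c cF] : exists c, c \notin F.
    have /card_gt0P[c] : 0 < #|~: F| by rewrite -(ltn_add2l #|F|) addn0 cardsC.
    by rewrite inE; exists c.
  exists (v |: S), (fun w => if w == v then c else col w); split.
    by move: vS; rewrite inE cardsU1 => ->; rewrite cardS.
  have c_new e w : e \in H -> v \in e -> w \in e -> c <> col w.
    move=> eH ve we def_c; case/negP: cF; rewrite def_c imset_f //.
    by apply/bigcupP; exists e; rewrite // inE eH.
  move=> e eH w w'; rewrite !inE => /andP[we wS] /andP[w'e w'S].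
  case: (eqVneq w v) wS => [eqw|_] /= wS;
    case: (eqVneq w' v) w'S => [eqw'|_] /= w'S.
  - by rewrite eqw eqw'.
  - by move/(c_new e w' eH) => []; rewrite -?eqw.
  - by move/esym/(c_new e w eH) => []; rewrite -?eqw'.
  - by apply: (colS e eH); rewrite inE ?we ?w'e.
have [S [col [cardS colS]]] := step _ (leqnn _).
have /eqP ST : S == setT by rewrite eqEcard subsetT cardsT cardS leqnn.
by exists col => e /colS; rewrite ST setIT.
Qed.

(** The pair [(a, x)] is vertex [x] of block [a]; [y] picks one vertex in each block [sigma j]. *)
Definition mono_tuples (k q l R N : nat) (chi : {set 'I_R * 'I_N} -> 'I_q)
    (sigma : {ffun 'I_l -> 'I_R}) (i : 'I_q) : {set {ffun 'I_l -> 'I_N}} :=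
  [set y : {ffun 'I_l -> 'I_N} | [forall K : {set 'I_l}, (#|K| == k) ==>
    (chi [set (sigma j, y j) | j in K] == i)]].

Lemma card_pullback (I J X : finType) (sigma : I -> J)
    (G : {set {ffun I -> X}}) :
  injective sigma -> 0 < #|X| ->
  #|[set z : {ffun J -> X} | [ffun j => z (sigma j)] \in G]| * #|X| ^ #|I|
    = #|G| * #|X| ^ #|J|.
Proof.
move=> inj_sigma /card_gt0P[x0 _].
pose pull (z : {ffun J -> X}) : {ffun I -> X} := [ffun j => z (sigma j)].
rewrite -sum1dep_card (partition_big pull (mem G)) //=.
rewrite big_distrl -sum_nat_const /=; apply: eq_bigr => y yG.
pose h j := if [pick i | sigma i == j] is Some i then y i else x0.
have hE i : h (sigma i) = y i.
  by rewrite /h; case: pickP => [i' /eqP/inj_sigma-> //|/(_ i)/eqP].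
rewrite -(card_agree [set sigma i | i in setT] h) card_imset // cardsT.
congr (_ * _); rewrite sum1dep_card; apply: eq_card => z; rewrite !inE.
apply/andP/forall_inP=> [[_ /eqP zy] _ /imsetP[i _ ->]|agr].
  by rewrite hE -zy ffunE.
have pz : pull z = y.
  by apply/ffunP=> i; rewrite ffunE -hE; apply/eqP/agr/imset_f; rewrite inE.
by rewrite -/(pull z) pz yG eqxx.
Qed.

(** Every transversal [z] of the [R] blocks contains a homogeneous l-set. The pigeonhole principle
    over the pairs [(sigma, i)] fixes its blocks and colour, and [card_pullback] forgets the other
    blocks. *)
Lemma dense_mono_tuples k q l R N (chi : {set 'I_R * 'I_N} -> 'I_q) :
  0 < N -> ramsey_bound k q l R ->
  exists (sigma : {ffun 'I_l -> 'I_R}) (i : 'I_q),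
    injective sigma /\ N ^ l <= R ^ l * q * #|mono_tuples k chi sigma i|.
Proof.
move=> N0 ramR.
pose P (c : {ffun 'I_l -> 'I_R} * 'I_q) (z : {ffun 'I_R -> 'I_N}) :=
  injectiveb c.1 && ([ffun j => z (c.1 j)] \in mono_tuples k chi c.1 c.2).
have samples0 : 0 < #|[set: {ffun 'I_R -> 'I_N}]|.
  by rewrite cardsT card_ffun !card_ord expn_gt0 N0.
have [|[sigma i]] := pigeonhole (P := P) samples0.
  move=> z _; pose chi' (K : {set 'I_R}) := chi [set (a, z a) | a in K].
  have [|L [i [_ cardL homL]]] := ramR _ chi' setT.
    by rewrite cardsT card_ord.
  pose sigma := [ffun j : 'I_l => enum_val (cast_ord (esym cardL) j)].
  have inj_sigma : injective sigma.
    by move=> j j'; rewrite !ffunE => /enum_val_inj/cast_ord_inj.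
  exists (sigma, i); rewrite /P /=; apply/andP; split; first exact/injectiveP.
  rewrite inE; apply/forallP=> K; apply/implyP=> /eqP cardK.
  rewrite -(homL (sigma @: K)); last by rewrite card_imset.
    rewrite /chi' -imset_comp; apply/eqP; congr chi; apply: eq_imset => j.
    by rewrite /=; congr pair; rewrite [LHS]ffunE.
  apply/subsetP=> a /imsetP[j _ ->]; rewrite ffunE; exact: enum_valP.
set A := [set z in _ | _] => leA.
have A0 : 0 < #|A|.
  by rewrite lt0n; apply: contraTneq leA => ->; rewrite muln0 -ltnNge.
have inj_sigma : injective sigma.
  by have /card_gt0P[z] := A0; rewrite inE => /andP[_ /andP[/injectiveP]].
exists sigma, i; split=> //.
have NR : 0 < N ^ R by rewrite expn_gt0 N0.
have X0 : 0 < #|'I_N| by rewrite card_ord.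
have := card_pullback (mono_tuples k chi sigma i) inj_sigma X0.
rewrite !card_ord => pullE; rewrite -(leq_pmul2r NR) -mulnA -pullE mulnA.
rewrite mulnC leq_mul2r; apply/orP; right.
move: leA; rewrite cardsT card_prod !card_ffun !card_ord => /leq_trans-> //.
rewrite leq_mul2l; apply/orP; right; apply: subset_leq_card.
apply/subsetP=> z; rewrite [z \in A]in_set => /andP[_ /andP[_ zG]].
by rewrite in_set.
Qed.

Lemma embed_in_mono_tuples k q l R N Delta D (chi : {set 'I_R * 'I_N} -> 'I_q)
    (sigma : {ffun 'I_l -> 'I_R}) (i : 'I_q) (V : finType) (H : hypergraph V) :
  0 < k -> 0 < Delta -> l = (k * Delta).+1 -> 0 < N -> injective sigma ->
  N ^ l <= D * #|mono_tuples k chi sigma i| ->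
  uniform k H -> (forall v, degree H v <= Delta) ->
  2 * sparsity Delta.+1 l D * (#|V| * (1 + Delta.+1 * l)) <= N ->
  exists f : V -> 'I_R * 'I_N,
    injective f /\ forall e, e \in H -> chi (f @: e) = i.
Proof.
move=> k0 Delta0 def_l N0 inj_sigma dense uniH degH leN.
have [col0 inj_col0] := strong_colouring uniH degH.
pose col v := cast_ord (esym def_l) (col0 v).
have inj_col e : e \in H -> {in e &, injective col}.
  by move=> eH v w ve we /cast_ord_inj; apply: inj_col0 eH _ _ ve we.
(* Singletons are added as edges so that no vertex is isolated, and edges are
   completed to l-sets with private new vertices inr (e, j). *)
pose E0 : {set {set V}} := H :|: [set [set v] | v in setT].
have inj_colE e : e \in E0 -> {in e &, injective col}.
  rewrite inE => /orP[/inj_col//|/imsetP[u _ ->]] v w.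
  by rewrite !inE => /eqP-> /eqP->.
pose E := {e : {set V} | e \in E0}.
pose W0 := (V + E * 'I_l)%type.
pose vert0 (e : E) (j : 'I_l) : W0 :=
  if [pick v in val e | col v == j] is Some v then inl v else inr (e, j).
pose colW (w : W0) : 'I_l := match w with inl v => col v | inr (_, j) => j end.
have col_vert0 e j : colW (vert0 e j) = j.
  by rewrite /vert0; case: pickP => [v /andP[_ /eqP]|].
have vert0_in (e : E) v : v \in val e -> vert0 e (col v) = inl v.
  move=> ve; rewrite /vert0; case: pickP => [w /andP[we /eqP eq_col]|/(_ v)].
    by rewrite (inj_colE _ (valP e) _ _ we ve eq_col).
  by rewrite ve eqxx.
(* If [e] has a vertex of colour [j], then [inr (e, j)] lies on no edge. Such vertices are
   discarded, since [dense_embedding] wants every vertex covered. *)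
pose isvert (w : W0) := [exists e, vert0 e (colW w) == w].
have isvert_vert e j : isvert (vert0 e j).
  by apply/existsP; exists e; rewrite col_vert0.
pose W := {w : W0 | isvert w}.
pose vert e j : W := exist _ (vert0 e j) (isvert_vert e j).
have cardE : #|{: E}| <= #|V| * Delta.+1.
  rewrite card_sig mulnS addnC; apply: leq_trans (leq_card_setU _ _) _.
  rewrite leq_add //; last by rewrite (leq_trans (leq_imset_card _ _)) ?cardsT.
  have HU : H \subset \bigcup_v [set e in H | v \in e].
    apply/subsetP=> e eH; have /card_gt0P[v ve] : 0 < #|e| by rewrite uniH.
    by apply/bigcupP; exists v; rewrite // inE eH.
  rewrite (leq_trans (subset_leq_card HU)) // -sum_nat_const.
  elim/big_rec2: _ => [|v m A _ leA]; first by rewrite cards0.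
  by apply: leq_trans (leq_card_setU _ _) _; rewrite leq_add ?degH.
have cardW : #|{: W}| <= #|V| * (1 + Delta.+1 * l).
  rewrite card_sig (leq_trans (max_card _)) // card_sum card_prod card_ord.
  by rewrite mulnDr muln1 leq_add2l mulnA leq_mul2r cardE orbT.
have [| | |v|w||f [injf edgef]] := @dense_embedding N l Delta.+1 D
    (mono_tuples k chi sigma i) W E vert (fun w => colW (val w)) N0 _ _ dense.
- by rewrite def_l.
- by [].
- by move=> e j; apply: col_vert0.
- have /existsP[e /eqP ev] := valP v.
  by exists e; apply: val_inj.
(* A vertex of [V] gains its singleton, whence [Delta.+1]; a private vertex lies on a single
   edge. *)
- case: w => w w_vert; rewrite /=; case: w w_vert => [v|[e0 j]] w_vert.
    apply: (@leq_trans #|[set e in H | v \in e] :|: [set [set v]]|); last first.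
      by apply: leq_trans (leq_card_setU _ _) _; rewrite cards1 addn1 ltnS degH.
    rewrite -(card_imset _ val_inj) subset_leq_card //.
    apply/subsetP=> y /imsetP[e]; rewrite inE => /eqP/(congr1 val) /= ev ->.
    have ve : v \in val e.
      by move: ev; rewrite /vert0; case: pickP => // u /andP[ue _] [<-].
    have := valP e; rewrite !inE => /orP[->|/imsetP[u _ def_e]].
      by rewrite ve.
    by move: ve; rewrite def_e inE => /eqP->; rewrite [sval e]def_e eqxx orbT.
  apply: (@leq_trans #|[set e0]|); last by rewrite cards1.
  apply/subset_leq_card/subsetP=> e; rewrite inE => /eqP/(congr1 val) /=.
  by rewrite /vert0; case: pickP => // _ [->]; rewrite inE.
- by apply: leq_trans leN; rewrite leq_mul2l cardW orbT.
have isvert_inl v : isvert (inl v).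
  have vE : [set v] \in E0 by rewrite inE imset_f ?orbT // inE.
  apply/existsP; exists (exist _ [set v] vE); rewrite /= vert0_in //=.
  by rewrite inE.
pose g v : 'I_R * 'I_N := (sigma (col v), f (exist _ (inl v) (isvert_inl v))).
exists g; split=> [v w [_ /injf /(congr1 val) [->]] //|e eH].
have eE : e \in E0 by rewrite inE eH.
(* The colours of [e] form a k-subset of the coordinates, and restricting to it drops the private
   vertices. *)
have := edgef (exist _ e eE); rewrite inE => /forallP/(_ (col @: e)).
rewrite card_in_imset; last exact: inj_col.
rewrite uniH // eqxx -imset_comp => /eqP <-; congr chi.
apply: eq_in_imset => v ve; rewrite /g /= ffunE; congr (_, f _).
by apply: val_inj; rewrite /= vert0_in.
Qed.

(** * Tower bounds *)

Import Order.TTheory GRing.Theory Num.Theory.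

(** The number [R] of blocks times the block size per vertex of [H]. The density is at least
    [1 / (R ^ l * q)], and completing the edges costs the last factor in vertices. *)
Definition ramsey_const (Delta k q : nat) : nat :=
  let l := (k * Delta).+1 in
  let R := ramsey_nat q l k in
  R * (2 * sparsity Delta.+1 l (R ^ l * q) * (1 + Delta.+1 * l)).

Lemma arrows_linear Delta k q n (V : 'I_q -> finType)
    (H : forall i, hypergraph (V i)) :
  0 < Delta -> 0 < k -> 0 < q -> 0 < n -> (forall i, #|V i| = n) ->
  (forall i, uniform k (H i)) -> (forall i, max_degree (H i) <= Delta) ->
  arrows k H (ramsey_const Delta k q * n).
Proof.
move=> Delta0 k0 q0 n0 cardV uniH degH.
rewrite /ramsey_const; set l := (k * Delta).+1; set R := ramsey_nat q l k.
rewrite -mulnA; set N := 2 * _ * _ * n => chi.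
have R0 : 0 < R.
  rewrite /R; case: (k) k0 => // -[|k'] _; first by rewrite muln_gt0 q0.
  by rewrite /= expn_gt0 muln_gt0 q0.
have N0 : 0 < N.
  have D0 : 0 < R ^ l * q by rewrite muln_gt0 expn_gt0 R0.
  by rewrite muln_gt0 n0 muln_gt0 andbT muln_gt0 sparsity_gt0.
have cardRN : #|{: 'I_R * 'I_N}| = R * N by rewrite card_prod !card_ord.
pose phi (x : 'I_R * 'I_N) : 'I_(R * N) := cast_ord cardRN (enum_rank x).
have inj_phi : injective phi by move=> x y /cast_ord_inj/enum_rank_inj.
(* The default colour is given only to sets whose size is not [k]. *)
pose chi' (S : {set 'I_R * 'I_N}) : 'I_q :=
  if insub (phi @: S) is Some E then chi E else Ordinal q0.
have [sigma [i [inj_sigma dense]]] :=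
  dense_mono_tuples chi' N0 (@ramsey_natP q l k (ltn0Sn _) k0).
have degHi v : degree (H i) v <= Delta.
  by rewrite (leq_trans _ (degH i)) // /max_degree leq_bigmax.
have [|f [injf colf]] := embed_in_mono_tuples k0 Delta0 (erefl l) N0 inj_sigma
  dense (uniH i) degHi.
  by rewrite cardV [n * _]mulnC mulnA.
exists i, (phi \o f); first exact: inj_comp.
move=> e eH; have := colf e eH; rewrite /chi' -imset_comp.
case: insubP => [E _ defE chiE|]; first by exists E.
by rewrite card_imset ?uniH ?eqxx //; apply: inj_comp.
Qed.

Lemma least_arrows k q (V : 'I_q -> finType)
    (H : forall i, hypergraph (V i)) N :
  arrows k H N -> exists2 r, is_ramsey_number k H r & r <= N.
Proof.
move=> arrN; have ex : exists r, `[< arrows k H r >] by exists N; apply/asboolP.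
case: (ex_minnP ex) => r /asboolP arr min; exists r.
  by split=> // m arrm; apply: min; apply/asboolP.
by apply: min; apply/asboolP.
Qed.

Definition ntower (i x : nat) : nat := iter i.-1 (expn 2) x.

Lemma ntowerS i x : 0 < i -> ntower i.+1 x = 2 ^ ntower i x.
Proof. by case: i. Qed.

Lemma leq_ntower i x y : x <= y -> ntower i x <= ntower i y.
Proof.
move=> lexy; rewrite /ntower; elim: (i.-1) => // j IHj.
by rewrite /= leq_exp2l.
Qed.

Lemma ntower_gt0 i x : 0 < x -> 0 < ntower i x.
Proof.
move=> x0; rewrite /ntower; elim: (i.-1) => // j IHj.
by rewrite /= expn_gt0.
Qed.

Lemma leq_mul_expn2 a y : 0 < y -> a * 2 ^ y <= 2 ^ (a * y).
Proof.
move=> y0; case: a => // a; rewrite [_ * y]mulSn addnC expnD leq_mul2r orbC.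
apply/orP; left; apply: leq_trans (ltn_expl a (isT : 1 < 2)) _.
by rewrite leq_exp2l // leq_pmulr.
Qed.

(** A factor passes under every exponential, so constants can be collected in the argument of the
    tower. *)
Lemma mul_ntower a i x : 0 < x -> a * ntower i x <= ntower i (a * x).
Proof.
move=> x0; rewrite /ntower; elim: (i.-1) => // j IHj.
rewrite !iterS; apply: leq_trans (leq_mul_expn2 _ _) _.
  exact: (ntower_gt0 j.+1).
by rewrite leq_exp2l.
Qed.

Lemma ntower_leq_height i j x : 0 < i -> i <= j -> ntower i x <= ntower j x.
Proof.
move=> i0 /subnKC <-; elim: (j - i) => [|m IHm]; first by rewrite addn0.
rewrite addnS ntowerS ?addn_gt0 ?i0 //.
by apply: leq_trans IHm (ltnW (ltn_expl _ _)).
Qed.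

Fixpoint ramsey_coef (q k : nat) : nat :=
  if k is k'.+1 then if k' is 0 then q else (q + k') * ramsey_coef q k' else 1.

Lemma ramsey_coef_gt0 q k : 0 < q -> 0 < ramsey_coef q k.
Proof.
by move=> q0; elim: k => // -[|k] // IHk; rewrite muln_gt0 IHk addn_gt0 q0.
Qed.

(** If [r <= 2 ^ y] with [y] positive, then [(2 * q) ^ (r ^ k)] is at most [2 ^ 2 ^ ((q + k) * y)]:
    each step adds a level and a factor [q + k] in the argument. *)
Lemma ramsey_nat_bound q l k : 0 < q -> 0 < l -> 0 < k ->
  ramsey_nat q l k <= ntower k (ramsey_coef q k * l).
Proof.
move=> q0 l0; case: k => // k _; elim: k => [//|k IHk].
rewrite ntowerS // [ramsey_nat _ _ _]/= -/(ramsey_nat q l k.+1).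
set r := ramsey_nat q l k.+1 in IHk *.
have q2 : 2 * q <= 2 ^ q.
  by case: (q) q0 => // q' _; rewrite expnS leq_pmul2l // ltn_expl.
apply: (@leq_trans ((2 ^ q) ^ (r ^ k.+1))).
  by case: (r ^ k.+1) => // e; rewrite leq_exp2r.
rewrite -expnM leq_exp2l //.
have [k0|k0] := posnP k.
  rewrite /r k0; change (q * (q * l) ^ 1 <= (q + 1) * q * l).
  by rewrite expn1 mulnA !leq_mul2r leq_addr !orbT.
set c := ramsey_coef q k.+1 in IHk *.
have c0 : 0 < c * l by rewrite muln_gt0 ramsey_coef_gt0.
have cS : ramsey_coef q k.+2 = (q + k.+1) * c by [].
move: IHk; rewrite cS !ntowerS //; set y := ntower k _ => leR.
have y0 : 0 < y by apply: ntower_gt0.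
apply: (@leq_trans (2 ^ ((q + k.+1) * y))); last first.
  by rewrite leq_exp2l // -mulnA mul_ntower.
apply: (@leq_trans (2 ^ q * 2 ^ (y * k.+1))).
  by rewrite leq_mul ?(ltnW (ltn_expl _ _)) // expnM leq_exp2r.
by rewrite -expnD leq_exp2l // mulnDl [y * _]mulnC leq_add2r leq_pmulr.
Qed.

(** The two coefficients of [ramsey_const_bound], plus 3 to absorb a logarithm, doubled to merge two
    towers. *)
Definition growth (q k : nat) : nat :=
  2 * (ramsey_coef q k * (2 * k) + (3 + q + (k + 3) * (k + 6)) + 3).

(** The Ramsey bound gives the first summand. The second one comes from the exponent $(2dl)^l$ of
    dependent random choice, which is $2^{O(\Delta\log\Delta)}$ for fixed $k$. *)
Lemma ramsey_const_bound Delta k q : 0 < Delta -> 2 < k -> 0 < q ->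
  ramsey_const Delta k q <=
    2 ^ 2 ^ (ntower (k - 2) (ramsey_coef q k * (2 * k) * Delta)
      + (3 + q + (k + 3) * (k + 6)) * (Delta * (up_log 2 Delta).+1)).
Proof.
move=> Delta0 k2 q0; set lam := (up_log 2 Delta).+1.
set c1 := ramsey_coef q k * (2 * k); set y' := ntower _ _.
have k0 : 0 < k by apply: leq_trans k2.
rewrite /ramsey_const; set l := (k * Delta).+1; set R := ramsey_nat q l k.
have l0 : 0 < l by [].
have R_le : R <= 2 ^ 2 ^ y'.
  apply: leq_trans (ramsey_nat_bound q0 l0 k0) _.
  rewrite -[k in ntower k _](subnK (ltnW k2)) addn2 !ntowerS ?subn_gt0 //.
  rewrite !leq_exp2l // leq_ntower // /c1 -!mulnA leq_mul2l /l.
  apply/orP; right.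
  by rewrite mul2n -addnn -addn1 leq_add2l muln_gt0 k0.
set y := 2 ^ y' in R_le; have y0 : 0 < y by rewrite expn_gt0.
pose m := 2 * (Delta.+1 * l); have m0 : 0 < m by rewrite !muln_gt0.
(* The terms account for the factor [R], for the polynomial factors, and for the power [m ^ l] of
   [R ^ l * q]. *)
pose P := 1 + m ^ 4 + (l + q) * m ^ l.
have R0 : 0 < R.
  rewrite /R; case: (k) k0 => // -[|k'] _; first by rewrite muln_gt0 q0.
  by rewrite /= expn_gt0 muln_gt0 q0.
have const_le : R * (2 * sparsity Delta.+1 l (R ^ l * q) * (1 + Delta.+1 * l))
    <= 2 ^ (y * P).
  have D_le : R ^ l * q <= 2 ^ ((l + q) * y).
    apply: (@leq_trans (2 ^ (y * l) * 2 ^ q)).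
      by rewrite leq_mul ?(ltnW (ltn_expl _ _)) // expnM leq_exp2r.
    by rewrite -expnD leq_exp2l // mulnDl [y * l]mulnC leq_add2l leq_pmulr.
  have s_le : 2 * sparsity Delta.+1 l (R ^ l * q) * (1 + Delta.+1 * l)
      <= m ^ 4 * 2 ^ ((l + q) * y * m ^ l).
    rewrite /sparsity -/m expnM.
    have pow_le : (R ^ l * q) ^ m ^ l <= (2 ^ ((l + q) * y)) ^ m ^ l.
      by rewrite leq_exp2r // expn_gt0 m0.
    have : 2 * (4 * (Delta.+1 * l) ^ 2 * l) * (1 + Delta.+1 * l) <= m ^ 4.
      have l_le : l <= Delta.+1 * l by rewrite leq_pmull.
      rewrite /m; move: l_le l0; move: (Delta.+1 * l) => M lM l0; nia.
    move: pow_le; move: (_ ^ m ^ l) (_ ^ m ^ l) => u v uv le4.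
    rewrite mulnA mulnAC; exact: leq_mul.
  have -> : y * P = y + (y * m ^ 4 + y * ((l + q) * m ^ l)).
    by rewrite /P [y * _]mulnDr [y * (1 + _)]mulnDr muln1 addnA.
  rewrite [2 ^ (y + _)]expnD [2 ^ (y * m ^ 4 + _)]expnD leq_mul //.
  rewrite (leq_trans s_le) // leq_mul //.
    rewrite (leq_trans (ltnW (ltn_expl _ (isT : 1 < 2)))) // leq_exp2l //.
    by rewrite leq_pmull.
  by rewrite leq_exp2l // mulnA [y * _]mulnC.
apply: leq_trans const_le _; rewrite leq_exp2l // expnD leq_mul2l.
apply/orP; right; rewrite -/lam.
have lam0 : 0 < lam by [].
have Delta_le : Delta.+1 <= 2 ^ lam.
  have := up_logP Delta (isT : 1 < 2); rewrite /lam expnS; lia.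
have l_le2 : l <= 2 ^ (k + lam).
  rewrite expnD /l; have := ltn_expl k (isT : 1 < 2); move: Delta_le.
  move: (2 ^ lam) (2 ^ k) => u v; nia.
have m_le : m <= 2 ^ ((k + 3) * lam).
  apply: (@leq_trans (2 * (2 ^ lam * 2 ^ (k + lam)))).
    by rewrite leq_mul2l leq_mul.
  by rewrite -expnD -expnS leq_exp2l //; nia.
have P_le : P <= (3 + q) * m ^ (l + 5).
  have l_le_m : l <= m by rewrite /m; nia.
  have le0 : 1 <= m ^ (l + 5) by rewrite expn_gt0 m0.
  have le1 : m ^ 4 <= m ^ (l + 5) by rewrite leq_pexp2l //; lia.
  have le2 : m ^ l <= m ^ (l + 5) by rewrite leq_pexp2l //; lia.
  have le3 : l * m ^ l <= m ^ (l + 5).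
    apply: (@leq_trans (m ^ l.+1)).
      by rewrite expnS leq_mul2r l_le_m orbT.
    by rewrite leq_pexp2l //; lia.
  rewrite /P mulnDl [(3 + q) * _]mulnDl; move: le0 le1 le2 le3.
  move: (m ^ (l + 5)) (m ^ 4) (m ^ l) (l * _) => u a b c; nia.
apply: leq_trans P_le _.
have l_le : l + 5 <= (k + 6) * Delta by rewrite /l; nia.
apply: (@leq_trans (2 ^ (3 + q) * 2 ^ ((k + 3) * lam * ((k + 6) * Delta)))).
  rewrite leq_mul ?(ltnW (ltn_expl _ _)) // [X in _ <= X]expnM.
  rewrite (leq_trans (leq_pexp2l m0 l_le)) // leq_exp2r //.
  by rewrite muln_gt0 addn_gt0 Delta0 orbT.
rewrite -expnD leq_exp2l //; nia.
Qed.

Lemma growth_gt0 q k : 0 < growth q k.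
Proof. by rewrite muln_gt0 addnC. Qed.

(** Here the tower of height [k - 2] is linear, so the logarithmic summand stays visible. *)
Lemma ramsey_const3 Delta q : 0 < Delta -> 0 < q ->
  ramsey_const Delta 3 q <=
    ntower 3 (growth q 3 * (Delta * (up_log 2 Delta).+1)).
Proof.
move=> Delta0 q0; apply: leq_trans (ramsey_const_bound Delta0 _ q0) _ => //.
rewrite [ntower 3 _]/= !leq_exp2l // /growth.
have : Delta <= Delta * (up_log 2 Delta).+1 by rewrite leq_pmulr.
move: (_ * (2 * 3)) (3 + q + _) (Delta * _.+1) => c1 c2 L.
by rewrite /ntower /=; nia.
Qed.

(** Here the tower of height [k - 2] is at least exponential and absorbs the logarithmic summand. *)
Lemma ramsey_const4 Delta k q : 0 < Delta -> 3 < k -> 0 < q ->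
  ramsey_const Delta k q <= ntower k (growth q k * Delta).
Proof.
move=> Delta0 k3 q0.
apply: leq_trans (ramsey_const_bound Delta0 (ltnW k3) q0) _.
have k2 : 2 <= k by lia.
rewrite -[k in ntower k (growth _ _ * _)](subnK k2) addn2 !ntowerS; try lia.
rewrite !leq_exp2l // /growth.
have c10 : 0 < ramsey_coef q k * (2 * k) * Delta.
  by rewrite !muln_gt0 ramsey_coef_gt0 // Delta0 andbT; lia.
move: c10; set c1 := ramsey_coef q k * _; set c2 := 3 + q + _ => c10.
have c1_gt0 : 0 < c1 by move: c10; rewrite muln_gt0 => /andP[].
have leL : c2 * (Delta * (up_log 2 Delta).+1)
    <= ntower (k - 2) ((c2 + 3) * Delta).
  apply: (@leq_trans (ntower 2 ((c2 + 3) * Delta))); last first.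
    by apply: ntower_leq_height => //; lia.
  have lam_le : (up_log 2 Delta).+1 <= 2 * Delta.
    have : up_log 2 Delta <= Delta by rewrite up_log_min // ltnW // ltn_expl.
    lia.
  rewrite [ntower 2 _]/=.
  have e2 : c2 < 2 ^ c2 by rewrite ltn_expl.
  have eD : Delta < 2 ^ Delta by rewrite ltn_expl.
  apply: (@leq_trans (2 ^ c2 * (2 ^ Delta * (2 * 2 ^ Delta)))).
    rewrite !leq_mul // ?(ltnW e2) ?(ltnW eD) // (leq_trans lam_le) //.
    by rewrite leq_mul // ltnW.
  by rewrite -expnS -!expnD leq_exp2l //; nia.
have mon c : c <= c1 + c2 + 3 ->
    ntower (k - 2) (c * Delta) <= ntower (k - 2) ((c1 + c2 + 3) * Delta).
  by move=> le_c; rewrite leq_ntower // leq_mul2r le_c orbT.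
apply: (@leq_trans (2 * ntower (k - 2) ((c1 + c2 + 3) * Delta))).
  rewrite mul2n -addnn leq_add ?mon //; first by lia.
  by apply: leq_trans leL (mon _ _); lia.
rewrite -mulnA mul_ntower // muln_gt0 Delta0 andbT; lia.
Qed.

(** * Passage to real towers and the natural logarithm *)

Local Open Scope ring_scope.

Lemma tower_natr (R : realType) i x : tower i (x%:R : R) = (ntower i x)%:R.
Proof.
rewrite /tower /ntower; elim: i.-1 => // j IHj; rewrite !iterS IHj.
by rewrite powR_mulrn // natrX.
Qed.

Lemma ler_tower (R : realType) i (x y : R) : x <= y -> tower i x <= tower i y.
Proof.
move=> lexy; rewrite /tower; elim: i.-1 => // j IHj; rewrite !iterS.
by apply: ler_powR => //; rewrite ler1n.
Qed.

(** As $lam - 1 \le \log_2 \Delta$ and $1 \le \log_2 \Delta$, the left side is at most $3 \log_2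
    \Delta$. The summand 1 makes the constant at least 1, so that it also serves [k >= 4]. *)
Lemma up_log_ln (R : realType) Delta : (2 <= Delta)%N ->
  ((up_log 2 Delta).+1)%:R <= (1 + 3 / ln 2 : R) * ln Delta%:R.
Proof.
move=> Delta2; set lam := up_log 2 Delta.
have ln2 : 0 < ln 2 :> R by rewrite ln_gt0 // ltr1n.
have lnD : ln 2 <= ln Delta%:R :> R.
  by rewrite ler_ln ?posrE ?ltr0n ?ler_nat // (leq_trans _ Delta2).
have /andP[lt_lam _] := up_log_bounds (isT : (1 < 2)%N) Delta2.
have lam0 : (0 < lam)%N by rewrite up_log_gt0.
have lnlam : (lam.-1)%:R * ln 2 <= ln Delta%:R :> R.
  rewrite mulr_natl -lnXn // -natrX ler_ln ?posrE ?ltr0n ?expn_gt0 //.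
    by rewrite ler_nat ltnW.
  by rewrite (leq_trans _ Delta2).
have -> : (lam.+1)%:R = (lam.-1)%:R + 2 :> R.
  by rewrite -natrD addn2 prednK.
have le3 : ((lam.-1)%:R + 2) * ln 2 <= 3 * ln Delta%:R :> R by lra.
rewrite mulrDl mul1r -[X in X <= _]add0r lerD //; first by lra.
by rewrite mulrAC ler_pdivlMr.
Qed.

(** For [k = 3] the bound starts at [Delta = 2], because [ln Delta] vanishes at 1 and would cancel
    any constant. *)
Theorem mainTheorem5 (R : realType) :
  exists C : nat -> nat -> nat -> R,
    (forall Delta k q : nat, (0 < Delta)%N -> (0 < k)%N -> (0 < q)%N ->
       forall (n : nat) (V : 'I_q -> finType) (H : forall i, hypergraph (V i)),
         (forall i, #|V i| = n) ->
         (forall i, uniform k (H i)) ->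
         (forall i, max_degree (H i) = Delta) ->
         exists2 r : nat, is_ramsey_number k H r &
           r%:R <= C Delta k q * n%:R) /\
    exists c : nat -> nat -> R,
      (forall k q : nat, 0 < c k q) /\
      (forall Delta k q : nat, (0 < Delta)%N -> (4 <= k)%N -> (0 < q)%N ->
         C Delta k q <= tower k (c k q * Delta%:R)) /\
      (forall Delta q : nat, (2 <= Delta)%N -> (0 < q)%N ->
         C Delta 3%N q <= tower 3 (c 3%N q * Delta%:R * ln Delta%:R)).
Proof.
exists (fun Delta k q => (ramsey_const Delta k q)%:R); split.
  move=> Delta k q Delta0 k0 q0 n V H cardV uniH degH.
  (* Without vertices the maximum degree would be 0. *)
  have n0 : (0 < n)%N.
    rewrite lt0n; apply: contraTneq Delta0 => n0.
    rewrite -(degH (Ordinal q0)) /max_degree big1 // => v _.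
    by case: (fintype0 v); rewrite cardV.
  have degH' i : (max_degree (H i) <= Delta)%N by rewrite degH.
  have [r ramr le_r] :=
    least_arrows (arrows_linear Delta0 k0 q0 n0 cardV uniH degH').
  by exists r => //; rewrite -natrM ler_nat.
have ln2 : 0 < ln 2 :> R by rewrite ln_gt0 // ltr1n.
have a0 : 1 <= 1 + 3 / ln 2 :> R by rewrite lerDl divr_ge0 // ltW.
exists (fun k q => (growth q k)%:R * (1 + 3 / ln 2)); split; last split.
- by move=> k q; rewrite mulr_gt0 ?ltr0n ?growth_gt0 // (lt_le_trans ltr01).
- move=> Delta k q Delta0 k4 q0.
  apply: (@le_trans _ _ (ntower k (growth q k * Delta))%:R).
    by rewrite ler_nat ramsey_const4.
  rewrite -tower_natr ler_tower // natrM ler_wpM2r //.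
  by rewrite ler_peMr.
move=> Delta q Delta2 q0.
have Delta0 : (0 < Delta)%N by apply: leq_trans Delta2.
apply: (@le_trans _ _
  (ntower 3 (growth q 3 * (Delta * (up_log 2 Delta).+1)))%:R).
  by rewrite ler_nat ramsey_const3.
rewrite -tower_natr ler_tower // natrM [(Delta * _)%:R]natrM -!mulrA.
rewrite ler_wpM2l //.
rewrite [X in _ <= X]mulrCA ler_wpM2l //.
by rewrite up_log_ln.
Qed.
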